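(* Let $\alpha$ be a badly approximable irrational, i.e. $\inf_{n \in \mathbb{N}} n \| n \alpha \| >0$. Then for any integer $N \ge 1$, \[ \sum_{n=1}^N \frac{1}{\| n \alpha \|} = 2N \log N +O(N) \qquad \textrm{and} \qquad \sum_{n=1}^N \frac{1}{n \| n \alpha \|} = (\log N)^2 +O(\log N), \] with implied constants depending only on $\alpha$.
   Context: $\| x \|$ denotes the distance from $x \in \mathbb{R}$ to the nearest integer. In error terms, $\log x$ means $\log \max\{e,x\}$. *)

(* Defs.v *)
From mathcomp Require Import all_boot all_order all_algebra.
From mathcomp Require Import all_classical all_reals all_analysis.
Set Implicit Arguments.
Unset Strict Implicit.
Unset Printing Implicit Defensive.
Import Order.TTheory GRing.Theory Num.Theory.
Local Open Scope classical_set_scope.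
Local Open Scope ring_scope.

Definition dist_int {R : realType} (x : R) : R :=
  inf [set `|x - m%:~R| | m in [set: int]].

(* The infimum is over positive [n]: [n = 0] would make it vanish. *)
Definition badly_approximable {R : realType} (alpha : R) : Prop :=
  0 < inf [set n%:R * dist_int (n%:R * alpha) | n in [set n : nat | (0 < n)%N]].

(* Truncated logarithm, used in error terms only, so that a bound
   [O(log N)] is meaningful at [N = 1], where [ln 1 = 0]. *)
Definition log_err {R : realType} (x : R) : R := ln (Num.max (expR 1) x).

(* Main.v *)
Require Import Defs.
From mathcomp Require Import all_boot all_order all_algebra.
From mathcomp Require Import all_classical all_reals all_analysis.
From mathcomp Require Import zify ring lra.
Import Order.TTheory GRing.Theory Num.Theory.
Local Open Scope ring_scope.

(* The key point is that #{n <= N : N ||n alpha|| < k} = 2k + O(sqrt k) for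
   1 <= k <= N/2.  Dirichlet's theorem with parameter Q ~ N / sqrt k gives a
   reduced fraction p/q with |q alpha - p| < 1/Q, and bad approximability forces
   q to be of exact order Q.  On q consecutive integers n, each ||n alpha|| is
   within 2/q of ||r/q|| where r runs once over the residues modulo q, so such
   a block contributes 2q(k/N) + O(1) to the count, and there are N/q + O(1)
   blocks.

   Since N ||n alpha|| is bounded below for n <= N, 1/(N ||n alpha||) equals
   1/(f + 1) up to O(1/(f + 1)^2), where f is the integer part of
   N ||n alpha||.  Summation by parts in the values of f turns the count into
   2 log N + O(1), the error being controlled by the convergence of
   sum k^(-3/2).  The second estimate follows from the first by summation by
   parts in n. *)

Set Implicit Arguments.
Unset Strict Implicit.

(** * Distance to the nearest integer *)

Lemma dist_int_ge0 (R : realType) (x : R) : 0 <= dist_int x.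
Proof.
apply: lb_le_inf; first by exists `|x - 0%:~R|, 0.
by move=> _ [m _ <-].
Qed.

Lemma dist_int_le (R : realType) (x : R) (m : int) :
  dist_int x <= `|x - m%:~R|.
Proof.
apply: ge_inf; last by exists m.
by exists 0 => _ [k _ <-].
Qed.

(** Rounding [x] gives an [m] within 1/2; any other integer is at least 1 away from [m], hence at
    least 1/2 away from [x]. *)
Lemma dist_int_attained (R : realType) (x : R) :
  exists m : int, dist_int x = `|x - m%:~R| /\ `|x - m%:~R| <= 1 / 2.
Proof.
have /andP[] := floor_itv (x + 1 / 2); set m := Num.floor _ => m1 m2.
rewrite intrD in m2.
have hm : `|x - m%:~R| <= 1 / 2 by rewrite ler_norml; lra.
exists m; split => //; apply/eqP; rewrite eq_le dist_int_le /=.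
apply: lb_le_inf; first by exists `|x - 0%:~R|, 0.
move=> _ [k _ <-]; have [->//|nk] := eqVneq k m.
apply: (le_trans hm).
have : 1 <= `|k%:~R - m%:~R : R|.
  by rewrite -intrB -intr_norm (ler_int _ 1); lia.
have := ler_distD x k%:~R (m%:~R : R).
rewrite [`|k%:~R - x|]distrC; lra.
Qed.

Lemma dist_int_le_half (R : realType) (x : R) : dist_int x <= 1 / 2.
Proof. by have [m [->]] := dist_int_attained x. Qed.

Lemma dist_intDz (R : realType) (x : R) (k : int) :
  dist_int (x + k%:~R) = dist_int x.
Proof.
apply/eqP; rewrite eq_le; apply/andP; split.
- have [m [-> _]] := dist_int_attained x.
  apply: (le_trans (dist_int_le _ (m + k))); rewrite intrD.
  have -> : x + k%:~R - (m%:~R + k%:~R) = x - m%:~R by ring.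
  exact: lexx.
- have [m [-> _]] := dist_int_attained (x + k%:~R).
  apply: (le_trans (dist_int_le _ (m - k))).
  by rewrite intrB opprB addrA.
Qed.

Lemma dist_int_lip (R : realType) (x y : R) :
  dist_int x <= dist_int y + `|x - y|.
Proof.
have [m [-> _]] := dist_int_attained y.
apply: (le_trans (dist_int_le _ m)).
by have := ler_distD y x m%:~R; lra.
Qed.

Lemma badly_approximable_lb (R : realType) (alpha : R) :
  badly_approximable alpha ->
  exists2 c : R, 0 < c &
    forall n : nat, (0 < n)%N -> c <= n%:R * dist_int (n%:R * alpha).
Proof.
move=> h; eexists; first exact: h.
move=> n n0; apply: ge_inf; last by exists n.
by exists 0 => _ [k _ <-]; rewrite mulr_ge0 // dist_int_ge0.
Qed.

(** * Dirichlet's approximation theorem *)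

(** The [Q + 1] fractional parts of [j x], [0 <= j <= Q], fall into [Q] boxes of length [1/Q]; two
    in one box give [q] as the difference of their indices. *)
Lemma dirichlet_pigeonhole (R : realType) (x : R) (Q : nat) : (0 < Q)%N ->
  exists (q : nat) (p : int),
    (0 < q <= Q)%N /\ `|q%:R * x - p%:~R| < Q%:R^-1.
Proof.
move=> Q0; have Q0R : 0 < Q%:R :> R by rewrite ltr0n.
pose fr (j : nat) : R := j%:R * x - (Num.floor (j%:R * x))%:~R.
have fr_itv j : 0 <= fr j < 1.
  by have := floor_itv (j%:R * x); rewrite /fr intrD; lra.
pose a j := Num.truncn (Q%:R * fr j).
have a_itv j : (a j)%:R <= Q%:R * fr j < (a j)%:R + 1.
  rewrite natr1; apply: truncn_itv; apply: mulr_ge0; first exact: ltW.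
  by case/andP: (fr_itv j).
have aQ j : (a j < Q)%N.
  rewrite -(ltr_nat R); have := a_itv j; have := fr_itv j; nra.
pose f (j : 'I_Q.+1) := Ordinal (aQ j).
have /injectivePn[i [j nij fij]] : ~~ injectiveb f.
  by apply/negP => /injectiveP /leq_card; rewrite !card_ord ltnn.
have {f fij} aij : a i = a j by case: fij.
wlog ltij : i j nij aij / (i < j)%N => [hw|].
  case: (ltngtP i j) => [|hji|/val_inj eij]; first exact: hw.
  - by apply: (hw j i) => //; rewrite eq_sym.
  - by rewrite eij eqxx in nij.
exists (j - i)%N, (Num.floor (j%:R * x) - Num.floor (i%:R * x)); split.
  by have := ltn_ord j; lia.
rewrite natrB 1?ltnW // intrB.
have -> : (j%:R - i%:R) * x -
  ((Num.floor (j%:R * x))%:~R - (Num.floor (i%:R * x))%:~R) = fr j - fr i.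
  by rewrite /fr; ring.
rewrite -(ltr_pM2l Q0R) mulfV ?gt_eqF // -[X in X * `|_|](gtr0_norm Q0R).
rewrite -normrM ltr_norml mulrBr.
by have := a_itv i; have := a_itv j; rewrite aij; lra.
Qed.

(** Dividing [p0] and [q0] by their gcd [d] divides the error by [d]. Coprimality later makes [j p]
    run through all residues modulo [q]. *)
Lemma dirichlet_coprime (R : realType) (x : R) (Q : nat) : (0 < Q)%N ->
  exists (q : nat) (p : int),
    [/\ (0 < q <= Q)%N, coprimez p q & `|q%:R * x - p%:~R| < Q%:R^-1].
Proof.
move=> Q0; have [q0 [p0 [/andP[q00 q0Q] h]]] := dirichlet_pigeonhole x Q0.
pose d := gcdn `|p0|%N q0.
have d0 : (0 < d)%N by rewrite gcdn_gt0 q00 orbT.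
have q0E : q0 = (q0 %/ d * d)%N by rewrite divnK // dvdn_gcdr.
have p0E : p0 = (p0 %/ d%:Z)%Z * d%:Z.
  by rewrite divzK // dvdzE /= dvdn_gcdl.
set q := (q0 %/ d)%N in q0E *; set p := (p0 %/ d%:Z)%Z in p0E *.
exists q, p; split.
- by rewrite divn_gt0 // dvdn_leq ?dvdn_gcdr //= (leq_trans (leq_div _ _)).
- rewrite coprimezE /= /coprime -(eqn_pmul2r d0) mul1n muln_gcdl -q0E.
  have -> : (`|p| * d = `|p0|)%N by rewrite [in RHS]p0E abszM.
  by rewrite eqxx.
- apply: le_lt_trans h; rewrite [in leRHS]q0E [in leRHS]p0E natrM intrM.
  have -> : q%:R * d%:R * x - p%:~R * d%:~R = (q%:R * x - p%:~R) * d%:R by ring.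
  by rewrite normrM ler_peMr // ger0_norm // ler1n.
Qed.

(** * Counting in a complete residue system *)

Definition count_lt (R : realType) (F : nat -> R) (q : nat) (v : R) : R :=
  \sum_(0 <= r < q) (F r < v)%R%:R.

Lemma count_ltS (R : realType) (F : nat -> R) (q : nat) (v : R) :
  count_lt F q.+1 v = count_lt F q v + (F q < v)%R%:R.
Proof. by rewrite /count_lt big_nat_recr. Qed.

Lemma count_lt_ge0 (R : realType) (F : nat -> R) (q : nat) (v : R) :
  0 <= count_lt F q v.
Proof. by apply: sumr_ge0 => r _; rewrite ler0n. Qed.

Lemma count_lt_le (R : realType) (F G : nat -> R) (q : nat) (v w : R) :
  (forall r, (r < q)%N -> F r < v -> G r < w) ->
  count_lt F q v <= count_lt G q w.
Proof.
move=> h; apply: ler_sum_nat => r /andP[_ rq]; rewrite ler_nat.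
by case: (boolP (F r < v)) => // /(h r rq) ->.
Qed.

(** The bound by [q] carries the induction: when [q < v], the new term leaves the count at most
    [q + 1 <= v + 1]. *)
Lemma count_nat_ub (R : realType) (v : R) (q : nat) : 0 <= v ->
  count_lt (fun r => r%:R) q v <= Num.min q%:R (v + 1).
Proof.
move=> v0; elim: q => [|q IH].
  by rewrite /count_lt big_geq // le_min lexx; lra.
move: IH; rewrite count_ltS !le_min -natr1 => /andP[h1 h2].
by case: (ltP q%:R v) => /= hq; apply/andP; split; lra.
Qed.

Lemma count_nat_lb (R : realType) (v : R) (q : nat) :
  Num.min q%:R v <= count_lt (fun r => r%:R) q v.
Proof.
elim: q => [|q IH].
  by rewrite /count_lt big_geq // ge_min lexx.
move: IH; rewrite count_ltS !ge_min -natr1.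
case: (ltP q%:R v) => /= hq /orP[] h; apply/orP; (try by right; lra); left; lra.
Qed.

Lemma count_nat_rev (R : realType) (v : R) (q : nat) :
  count_lt (fun r => q%:R - r%:R) q v = count_lt (fun r => r%:R) q (v - 1).
Proof.
rewrite /count_lt big_nat_rev /=; apply: eq_big_nat => r /andP[_ rq].
rewrite add0n natrB // -natr1.
congr (nat_of_bool _)%:R; apply/idP/idP => h; lra.
Qed.

(** A residue is counted only if it lies within [v] of one of the ends 0 and [q]; each end is
    counted separately. *)
Lemma count_dist_int_ub (R : realType) (v : R) (q : nat) :
  (0 < q)%N -> 0 <= v ->
  count_lt (fun r => dist_int (r%:R / q%:R)) q (v / q%:R) <= 2 * v + 2.
Proof.
move=> q0 v0; have q0R : 0 < q%:R :> R by rewrite ltr0n.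
have := count_nat_ub q v0; rewrite le_min => /andP[_ h1].
have h2 : count_lt (fun r => q%:R - r%:R) q v <= v + 1.
  rewrite count_nat_rev; apply: le_trans h1; apply: count_lt_le => r _.
  lra.
suff h3 : count_lt (fun r => dist_int (r%:R / q%:R)) q (v / q%:R)
    <= count_lt (fun r => r%:R) q v + count_lt (fun r => q%:R - r%:R) q v.
  lra.
rewrite -big_split /=; apply: ler_sum_nat => r /andP[_ rq].
case: ltP => /= h; last by rewrite addr_ge0.
suff : (r%:R < v) || (q%:R - r%:R < v).
  by case: (ltP r%:R v) => /= _; case: (ltP (q%:R - r%:R) v) => //= _; lra.
have [m [mE _]] := dist_int_attained (r%:R / q%:R : R).
have {h} : `|r%:R - m%:~R * q%:R| < v.
  have -> : r%:R - m%:~R * q%:R = (r%:R / q%:R - m%:~R) * q%:R :> R.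
    by rewrite mulrBl divfK ?gt_eqF.
  by rewrite normrM (gtr0_norm q0R) -mE -ltr_pdivlMr.
rewrite ltr_norml => /andP[h1' h2']; apply/orP.
have [m0|m0] := lerP m 0.
  have m0R : (m%:~R : R) <= 0 by rewrite (ler_int _ m 0).
  left; nra.
have m0R : 1 <= (m%:~R : R) by rewrite (ler_int _ 1 m).
right; nra.
Qed.

(** For [v <= q/2] no residue is near both ends, so the two counts add up. The loss of 1 comes from
    the upper end, where [q - r] starts at 1. *)
Lemma count_dist_int_lb (R : realType) (v : R) (q : nat) :
  (0 < q)%N -> v <= q%:R / 2 ->
  2 * v - 1 <= count_lt (fun r => dist_int (r%:R / q%:R)) q (v / q%:R).
Proof.
move=> q0 vq; have q0R : 0 < q%:R :> R by rewrite ltr0n.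
have h1 : v <= count_lt (fun r => r%:R) q v.
  by have := count_nat_lb v q; rewrite ge_min => /orP[]; lra.
have h2 : v - 1 <= count_lt (fun r => q%:R - r%:R) q v.
  rewrite count_nat_rev.
  by have := count_nat_lb (v - 1) q; rewrite ge_min => /orP[]; lra.
suff h3 : count_lt (fun r => r%:R) q v + count_lt (fun r => q%:R - r%:R) q v
    <= count_lt (fun r => dist_int (r%:R / q%:R)) q (v / q%:R).
  lra.
rewrite -big_split /=; apply: ler_sum_nat => r /andP[_ rq].
have rqR : r%:R <= q%:R :> R by rewrite ler_nat ltnW.
have hd (m : int) : `|r%:R - m%:~R * q%:R| < v ->
    dist_int (r%:R / q%:R) < v / q%:R.
  move=> h; apply: (le_lt_trans (dist_int_le _ m)).
  rewrite ltr_pdivlMr // -[X in _ * X < _](gtr0_norm q0R) -normrM.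
  by rewrite mulrBl divfK ?gt_eqF.
case: (ltP r%:R v) => /= hr; case: (ltP (q%:R - r%:R) v) => /= hr'; try lra.
- by rewrite (hd 0) // ?mulr0z ?mul0r ?subr0 ?ger0_norm //= addr0.
- rewrite (hd 1) // ?add0r // mulr1z mul1r distrC ger0_norm //; lra.
- by rewrite addr0.
Qed.

Lemma count_lt_perm (R : realType) (F : nat -> R) (q : nat)
    (h : nat -> nat) (v : R) :
  (forall j, (j < q)%N -> (h j < q)%N) ->
  (forall i j, (i < q)%N -> (j < q)%N -> h i = h j -> i = j) ->
  count_lt (fun j => F (h j)) q v = count_lt F q v.
Proof.
move=> hq hinj; rewrite /count_lt !big_mkord.
pose g (j : 'I_q) := Ordinal (hq j (ltn_ord j)).
rewrite [RHS](@reindex_inj _ _ _ _ g) // => i j /(congr1 val) /= /hinj eij.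
exact/val_inj/eij.
Qed.

(** * Counting small values of [||n alpha||] *)

(** The shift [beta] lets the block start anywhere. Passing to residues costs at most [2/q], so the
    complete-system bounds [2 v - 1] and [2 v + 2] are used at [v = t q - 2] and [v = t q + 2];
    hence 5 and 6. *)
Lemma count_block (R : realType) (alpha beta t : R) (q : nat) (p : int) :
  (0 < q)%N -> coprimez p q -> `|q%:R * alpha - p%:~R| <= q%:R^-1 ->
  0 <= t <= 1 / 2 ->
  2 * t * q%:R - 5 <=
    count_lt (fun j => dist_int (beta + j%:R * alpha)) q t <=
  2 * t * q%:R + 6.
Proof.
move=> q0 cpq hp /andP[t0 t1]; have q0R : 0 < q%:R :> R by rewrite ltr0n.
have qn0 : q%:R != 0 :> R by rewrite gt_eqF.
have qz0 : q%:Z != 0 by rewrite -lt0n.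
pose b := Num.floor (q%:R * beta).
have /andP[b1 b2] := floor_itv (q%:R * beta); rewrite intrD -/b in b1 b2.
(* [b + j p] is [q (beta + j alpha)] up to an error at most 2, and [h j] is
   its residue modulo [q]. *)
pose h j := `|((b + j%:Z * p) %% q%:Z)%Z|%N.
have hE j : (h j)%:Z = ((b + j%:Z * p) %% q%:Z)%Z.
  by rewrite gez0_abs // modz_ge0.
have hq j : (j < q)%N -> (h j < q)%N.
  by move=> _; rewrite -ltz_nat hE ltz_pmod.
have hinj i j : (i < q)%N -> (j < q)%N -> h i = h j -> i = j.
  move=> iq jq /(congr1 Posz); rewrite !hE => /eqP.
  rewrite eqz_mod_dvd.
  have -> : b + i%:Z * p - (b + j%:Z * p) = (i%:Z - j%:Z) * p by ring.
  rewrite Gauss_dvdzl 1?coprimez_sym // => /dvdzP[k kE].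
  have [k0|[k1|k1]] : k = 0 \/ 1 <= k \/ k <= -1 by lia.
  - by move: kE; rewrite k0 mul0r; lia.
  - have : q%:Z <= k * q%:Z by rewrite ler_peMl.
    rewrite -kE; lia.
  - have : k * q%:Z <= - q%:Z by rewrite -mulN1r ler_wpM2r.
    rewrite -kE; lia.
have hdist j : (j < q)%N ->
    `|beta + j%:R * alpha - (h j)%:R / q%:R
       - (((b + j%:Z * p) %/ q%:Z)%Z)%:~R| <= 2 / q%:R.
  move=> jq.
  have /(congr1 (fun z : int => z%:~R : R)) := divz_eq (b + j%:Z * p) q%:Z.
  rewrite -hE; set z := (_ %/ _)%Z; rewrite !intrD !intrM => zE.
  have -> : beta + j%:R * alpha - (h j)%:R / q%:R - z%:~R =
     ((q%:R * beta - b%:~R) + j%:R * (q%:R * alpha - p%:~R)) / q%:R.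
    have -> : b%:~R = z%:~R * q%:R + (h j)%:R - j%:R * p%:~R :> R by lra.
    by field.
  rewrite normrM normfV (gtr0_norm q0R) ler_pM2r ?invr_gt0 //.
  apply: (le_trans (ler_normD _ _)).
  have : `|q%:R * beta - b%:~R| <= 1 by rewrite ler_norml; lra.
  suff : `|j%:R * (q%:R * alpha - p%:~R)| <= 1 by lra.
  rewrite normrM normr_nat -[X in _ <= X](mulfV qn0); apply: ler_pM => //.
  by rewrite ler_nat ltnW.
have hup j : (j < q)%N ->
    dist_int ((h j)%:R / q%:R) <= dist_int (beta + j%:R * alpha) + 2 / q%:R.
  move=> jq; rewrite -[X in X <= _](dist_intDz _ ((b + j%:Z * p) %/ q%:Z)%Z).
  apply: (le_trans (dist_int_lip _ (beta + j%:R * alpha))).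
  by rewrite lerD2l distrC opprD addrA hdist.
have hlow j : (j < q)%N ->
    dist_int (beta + j%:R * alpha) <= dist_int ((h j)%:R / q%:R) + 2 / q%:R.
  move=> jq.
  rewrite -[X in _ <= X + _](dist_intDz _ ((b + j%:Z * p) %/ q%:Z)%Z).
  apply: (le_trans (dist_int_lip _ ((h j)%:R / q%:R +
    ((b + j%:Z * p) %/ q%:Z)%Z%:~R))).
  by rewrite lerD2l opprD addrA hdist.
apply/andP; split.
- have hv : t * q%:R - 2 <= q%:R / 2 by nra.
  have := count_dist_int_lb q0 hv.
  rewrite -(count_lt_perm _ _ hq hinj).
  suff h1 : count_lt (fun j => dist_int ((h j)%:R / q%:R)) q
    ((t * q%:R - 2) / q%:R) <=
    count_lt (fun j => dist_int (beta + j%:R * alpha)) q t by lra.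
  apply: count_lt_le => j jq; rewrite mulrBl mulfK // => hj.
  by have := hlow j jq; lra.
- have hv : 0 <= t * q%:R + 2 by nra.
  have := count_dist_int_ub q0 hv.
  rewrite -(count_lt_perm _ _ hq hinj).
  suff h1 : count_lt (fun j => dist_int (beta + j%:R * alpha)) q t <=
    count_lt (fun j => dist_int ((h j)%:R / q%:R)) q
    ((t * q%:R + 2) / q%:R) by lra.
  apply: count_lt_le => j jq; rewrite mulrDl mulfK // => hj.
  by have := hup j jq; lra.
Qed.

Lemma count_ltD (R : realType) (F : nat -> R) (m n : nat) (v : R) :
  count_lt F (m + n) v = count_lt F m v + count_lt (fun j => F (m + j)%N) n v.
Proof.
elim: n => [|n IH]; first by rewrite addn0 {3}/count_lt big_geq // addr0.
by rewrite addnS !count_ltS IH addrA.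
Qed.

(** The count is monotone in [N], so it lies between those of [M] and [M + 1] full blocks,
    [M = N %/ q]. Each full block costs at most 6, the incomplete one at most [2 t q + 6]. *)
Lemma count_initial (R : realType) (alpha t : R) (N q : nat) (p : int) :
  (0 < q)%N -> coprimez p q -> `|q%:R * alpha - p%:~R| <= q%:R^-1 ->
  0 <= t <= 1 / 2 ->
  `|count_lt (fun n => dist_int (n.+1%:R * alpha)) N t - 2 * t * N%:R|
    <= 6 * (N%:R / q%:R) + 2 * t * q%:R + 6.
Proof.
move=> q0 cpq hp ht; have q0R : 0 < q%:R :> R by rewrite ltr0n.
set F := (fun n : nat => _); have /andP[t0 t1] := ht.
have block m : 2 * t * q%:R - 5 <= count_lt (fun j => F (m + j)%N) q t <=
    2 * t * q%:R + 6.
  have := count_block (m.+1%:R * alpha) q0 cpq hp ht.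
  suff -> : (fun j => F (m + j)%N) =
    (fun j => dist_int (m.+1%:R * alpha + j%:R * alpha)) by [].
  by apply/funext => j; rewrite /F -mulrDl -natrD addSn.
have blocks M : M%:R * (2 * t * q%:R - 5) <= count_lt F (M * q) t <=
    M%:R * (2 * t * q%:R + 6).
  elim: M => [|M IH]; first by rewrite /count_lt big_geq // !mul0r lexx.
  by rewrite mulSnr count_ltD -natr1; have := block (M * q)%N; lra.
set M := (N %/ q)%N.
have NE : N = (M * q + N %% q)%N by exact: divn_eq.
have NER : N%:R = M%:R * q%:R + (N %% q)%:R :> R by rewrite {1}NE natrD natrM.
have rq : (N %% q < q)%N by rewrite ltn_mod.
have rqR : (N %% q)%:R < q%:R :> R by rewrite ltr_nat.
have r0 : 0 <= (N %% q)%:R :> R by [].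
set X := N%:R / q%:R.
have XE : N%:R = X * q%:R by rewrite divfK ?gt_eqF.
have MX : M%:R <= X by rewrite ler_pdivlMr // NER; lra.
have XM : X < M%:R + 1 by rewrite ltr_pdivrMr // NER; lra.
have lo : count_lt F (M * q) t <= count_lt F N t.
  by rewrite [in leRHS]NE count_ltD lerDl count_lt_ge0.
have hi : count_lt F N t <= count_lt F (M.+1 * q) t.
  have -> : (M.+1 * q = N + (q - N %% q))%N by rewrite mulSnr; lia.
  by rewrite count_ltD lerDl count_lt_ge0.
have tq0 : 0 <= t * q%:R by rewrite mulr_ge0.
have := blocks M.+1; have := blocks M; rewrite -natr1 ler_norml XE.
nra.
Qed.

(** With [t = k/N], the errors [N/q] and [t q] are both of order [sqrt k] when [q] is of order
    [N / sqrt k]; this dictates [Q]. *)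
Lemma count_badly_approximable (R : realType) (alpha : R) :
  badly_approximable alpha ->
  exists2 E : R, 0 <= E & forall N k : nat, (0 < k)%N -> (2 * k <= N)%N ->
    `|count_lt (fun n => N%:R * dist_int (n.+1%:R * alpha)) N k%:R - 2 * k%:R|
      <= E * Num.sqrt k%:R.
Proof.
move=> /badly_approximable_lb[c c0 hc].
(* With [s = sqrt k], the three error terms will be at most [6 s / c], [4 s] and [6 <= 6 s]. *)
exists (6 / c + 10); first by rewrite addr_ge0 // divr_ge0 // ltW.
move=> N k k0 kN; have N0 : (0 < N)%N by lia.
have k0R : 1 <= k%:R :> R by rewrite ler1n.
have kNR : 2 * k%:R <= N%:R :> R by rewrite -natrM ler_nat.
have N0R : 0 < N%:R :> R by rewrite ltr0n.
set s := Num.sqrt k%:R.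
have s1 : 1 <= s by rewrite -[X in X <= _]sqrtr1 ler_wsqrtr.
have ssk : s * s = k%:R by rewrite -expr2 sqr_sqrtr.
(* Since [N/s >= 1], this rounding keeps [Q] between [N/s] and [2 N/s]. *)
pose Q := (Num.truncn (N%:R / s)).+1.
have Ns0 : 1 <= N%:R / s by rewrite ler_pdivlMr; nra.
have /andP[] := @truncn_itv _ (N%:R / s) (ltW (lt_le_trans ltr01 Ns0)).
rewrite -/Q => Q1 Q2; have {}Q1 : Q%:R <= 2 * (N%:R / s).
  by rewrite /Q -natr1; lra.
have Q0 : 0 < Q%:R :> R by rewrite ltr0n.
have [q [p [/andP[q0 qQ] cpq hp]]] :=
  dirichlet_coprime alpha (ltn0Sn _ : (0 < Q)%N).
have q0R : 0 < q%:R :> R by rewrite ltr0n.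
have qQR : q%:R <= Q%:R :> R by rewrite ler_nat.
(* Bad approximability: [c <= q ||q alpha|| <= q |q alpha - p| <= q/Q]. *)
have cQ : c * Q%:R <= q%:R.
  rewrite -ler_pdivlMr //; apply: (le_trans (hc q q0)).
  rewrite ler_pM2l //; apply: (le_trans (dist_int_le _ p)); exact: ltW.
have hpq : `|q%:R * alpha - p%:~R| <= q%:R^-1.
  by apply: (le_trans (ltW hp)); rewrite lef_pV2 // posrE.
have ht : 0 <= (k%:R / N%:R : R) <= 1 / 2.
  by apply/andP; split; [exact: divr_ge0 | rewrite ler_pdivrMr //; lra].
have := count_initial N q0 cpq hpq ht.
have -> : count_lt (fun n => dist_int (n.+1%:R * alpha)) N (k%:R / N%:R) =
    count_lt (fun n => N%:R * dist_int (n.+1%:R * alpha)) N k%:R.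
  by apply: eq_bigr => n _; rewrite ltr_pdivlMr // mulrC.
have -> : 2 * (k%:R / N%:R) * N%:R = 2 * k%:R :> R.
  by rewrite -mulrA divfK ?gt_eqF.
move=> h; apply: (le_trans h).
have h1 : N%:R / q%:R <= s / c.
  rewrite ler_pdivrMr // mulrAC ler_pdivlMr //.
  move: Q2; rewrite ltr_pdivrMr; [nra | lra].
have h2 : 2 * (k%:R / N%:R) * q%:R <= 4 * s.
  have : q%:R * s <= 2 * N%:R.
    rewrite -ler_pdivlMr; last lra.
    by rewrite -mulrA; apply: (le_trans qQR).
  have -> : 2 * (k%:R / N%:R) * q%:R = (2 * k%:R * q%:R) / N%:R :> R by ring.
  rewrite ler_pdivrMr // -ssk; nra.
have -> : (6 / c + 10) * s = 6 * (s / c) + 10 * s by ring.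
lra.
Qed.

(** * Summation by parts over integer parts *)

(** The sum telescopes over [f <= k < K]; the indicator keeps the range independent of [f], so that
    sums can be exchanged. *)
Lemma layer_cake (R : realType) (g : nat -> R) (f K : nat) : (f <= K)%N ->
  g f = g K + \sum_(0 <= k < K) (f <= k)%N%:R * (g k - g k.+1).
Proof.
elim: K => [|K IH]; first by rewrite leqn0 => /eqP ->; rewrite big_geq // addr0.
rewrite leq_eqVlt => /orP[/eqP ->|fK].
  rewrite big_nat big1 ?addr0 // => k /andP[_ kK].
  by rewrite leqNgt kK mul0r.
by rewrite big_nat_recr //= IH // -ltnS fK mul1r; ring.
Qed.

(** As [Num.truncn (X n) <= k] means [X n < k + 1], exchanging the two sums makes the indicators add
    up to counts. *)
Lemma sum_trunc_count (R : realType) (g : nat -> R) (X : nat -> R) (N K : nat) :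
  (forall n, (n < N)%N -> X n < K.+1%:R) ->
  \sum_(0 <= n < N) g (Num.truncn (X n)) =
  N%:R * g K + \sum_(0 <= k < K) count_lt X N k.+1%:R * (g k - g k.+1).
Proof.
move=> hX.
transitivity (\sum_(0 <= n < N) (g K +
    \sum_(0 <= k < K) (X n < k.+1%:R)%R%:R * (g k - g k.+1))).
  apply: eq_big_nat => n /andP[_ nN].
  rewrite (@layer_cake _ g _ K) ?truncn_le_nat ?hX //; congr (_ + _).
  by apply: eq_bigr => k _; rewrite truncn_le_nat.
rewrite big_split /= sumr_const_nat subn0 -[g K *+ N]mulr_natl; congr (_ + _).
rewrite exchange_big /=; apply: eq_bigr => k _.
by rewrite mulr_suml.
Qed.

(** With [y = f + 1] the difference is [(y - x) / (x y)], where [y - x <= 1] and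
    [y <= x + 1 <= (1 + 1/c) x]. *)
Lemma inv_truncn_approx (R : realType) (c x : R) : 0 < c -> c <= x ->
  `|x^-1 - (Num.truncn x).+1%:R^-1| <= (1 + c^-1) * (Num.truncn x).+1%:R ^- 2.
Proof.
move=> c0 cx; have x0 : 0 < x by lra.
have /andP[] := truncn_itv (ltW x0); set f := Num.truncn x.
rewrite -natr1 => h1 h2.
set y := f%:R + 1 in h2 *; have yE : y = f%:R + 1 by []; have y0 : 0 < y by lra.
have -> : x^-1 - y^-1 = (y - x) / (x * y) by field; rewrite !gt_eqF.
rewrite ger0_norm; last by rewrite divr_ge0 ?mulr_ge0 //; lra.
rewrite ler_pdivrMr ?mulr_gt0 //.
have -> : (1 + c^-1) * y ^- 2 * (x * y) = (1 + c^-1) * x / y.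
  by field; rewrite !gt_eqF.
rewrite ler_pdivlMr //.
have hc : 1 <= x / c by rewrite ler_pdivlMr // mul1r.
have -> : (1 + c^-1) * x = x + x / c by field; rewrite gt_eqF.
have : (y - x) * y <= y by rewrite ler_piMl; lra.
have : y <= x + 1 by rewrite lerD2r.
lra.
Qed.

(** * Logarithms and convergent series *)

(** Both bounds are [ln (1 + u) <= u], at [u = -1/(n + 1)] and at [u = 1/n]. *)
Lemma ln_succ_bounds (R : realType) (n : nat) : (0 < n)%N ->
  n.+1%:R^-1 <= ln (n.+1%:R : R) - ln n%:R <= n%:R^-1.
Proof.
move=> n0; have n0R : 0 < n%:R :> R by rewrite ltr0n.
have n1R : 0 < n.+1%:R :> R by rewrite ltr0n.
have n1E : n.+1%:R = n%:R + 1 :> R by rewrite natr1.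
apply/andP; split.
- have : ln (1 + - n.+1%:R^-1 : R) <= - n.+1%:R^-1.
    by apply: le_ln1Dx; rewrite ltrN2 invf_lt1 // n1E; lra.
  have -> : 1 + - n.+1%:R^-1 = n%:R / n.+1%:R :> R.
    by rewrite n1E; field; rewrite gt_eqF // -n1E.
  by rewrite ln_div ?posrE // lerNr opprB.
- rewrite -ln_div ?posrE //.
  have -> : n.+1%:R / n%:R = 1 + n%:R^-1 :> R.
    by rewrite n1E; field; rewrite gt_eqF.
  by apply: le_ln1Dx; apply: (@lt_trans _ _ 0); rewrite ?invr_gt0 //; lra.
Qed.

Lemma harmonic_ln (R : realType) (K : nat) :
  `|\sum_(0 <= k < K) (k.+2%:R)^-1 - ln (K.+1%:R : R)| <= 1.
Proof.
pose S m : R := \sum_(0 <= k < m) (k.+2%:R)^-1.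
(* The extra [1/(K + 1)] closes the induction: the logarithm may grow by [1/(K + 1)] while the sum
   gains only [1/(K + 2)]. *)
suff : ln K.+1%:R - 1 + K.+1%:R^-1 <= S K <= ln (K.+1%:R : R).
  rewrite -[X in `|X - _|]/(S K) => /andP[h1 h2].
  have h0 : 0 <= K.+1%:R^-1 :> R by rewrite invr_ge0.
  move: (K.+1%:R^-1 : R) h0 h1 h2 => u h0 h1 h2.
  by rewrite ler_norml; apply/andP; split; lra.
elim: K => [|K IH]; first by rewrite /S big_geq // ln1 invr1; lra.
have -> : S K.+1 = S K + K.+2%:R^-1 by rewrite /S big_nat_recr.
have := @ln_succ_bounds R K.+1 isT; move: IH.
move: (K.+1%:R^-1 : R) (K.+2%:R^-1 : R) => u v; lra.
Qed.

Lemma sum_inv_mul_succ_le (R : realType) (K : nat) :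
  \sum_(0 <= k < K) (k.+1%:R * k.+2%:R)^-1 <= 1 :> R.
Proof.
suff -> : \sum_(0 <= k < K) (k.+1%:R * k.+2%:R)^-1 = 1 - K.+1%:R^-1 :> R.
  by rewrite gerBl invr_ge0.
elim: K => [|K IH]; first by rewrite big_geq // invr1 subrr.
rewrite big_nat_recr //= IH.
have h1 : 0 <= K%:R :> R by [].
rewrite -[K.+2%:R]natr1 -[K.+1%:R]natr1; field.
by rewrite !gt_eqF //; lra.
Qed.

Lemma sum_sqrt_le (R : realType) (K : nat) :
  \sum_(0 <= k < K) Num.sqrt k.+1%:R * (k.+1%:R * k.+2%:R)^-1 <= 2 :> R.
Proof.
(* With a = sqrt (k+1) and b = sqrt (k+2), the term is 1/(a b^2), at most
   2/a - 2/b = 2/(a b (a + b)). *)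
suff h : \sum_(0 <= k < K) Num.sqrt k.+1%:R * (k.+1%:R * k.+2%:R)^-1 <=
    2 - 2 * (Num.sqrt K.+1%:R)^-1 :> R.
  have : 0 <= (Num.sqrt K.+1%:R)^-1 :> R by rewrite invr_ge0 sqrtr_ge0.
  lra.
elim: K => [|K IH]; first by rewrite big_geq // sqrtr1 invr1; lra.
rewrite big_nat_recr //=.
have aE : Num.sqrt K.+1%:R ^+ 2 = K.+1%:R :> R by rewrite sqr_sqrtr.
have bE : Num.sqrt K.+2%:R ^+ 2 = K.+2%:R :> R by rewrite sqr_sqrtr.
have a0 : 0 < Num.sqrt K.+1%:R :> R by rewrite sqrtr_gt0.
have b0 : 0 < Num.sqrt K.+2%:R :> R by rewrite sqrtr_gt0.
move: IH; set S := \sum_(_ <= _ < _) _ => IH.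
have -> : (K.+1%:R * K.+2%:R)^-1 =
    (Num.sqrt K.+1%:R ^+ 2 * Num.sqrt K.+2%:R ^+ 2)^-1 :> R by rewrite aE bE.
move: aE bE a0 b0 IH; set a := Num.sqrt _; set b := Num.sqrt _.
move=> aE bE a0 b0 IH.
have ab : b ^+ 2 = a ^+ 2 + 1 by rewrite aE bE -natr1.
suff : a * (a ^+ 2 * b ^+ 2)^-1 <= 2 * a^-1 - 2 * b^-1 by lra.
have -> : a * (a ^+ 2 * b ^+ 2)^-1 = 1 / (a * b ^+ 2).
  by field; rewrite !gt_eqF.
have -> : 2 * a^-1 - 2 * b^-1 = (2 * b * (b - a)) / (a * b ^+ 2).
  by field; rewrite !gt_eqF.
rewrite ler_pM2r ?invr_gt0 ?mulr_gt0 ?exprn_gt0 //.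
nra.
Qed.

(** The summation over [k] stops at [N./2] because [||x|| <= 1/2]; this restores [ln N], using
    [N <= 2 (N./2 + 1)] and [ln 2 <= 1]. *)
Lemma ln_half_succ (R : realType) (N : nat) : (0 < N)%N ->
  `|ln (N./2.+1%:R : R) - ln N%:R| <= 1.
Proof.
move=> N0; have N0R : 0 < N%:R :> R by rewrite ltr0n.
have K0R : 0 < N./2.+1%:R :> R by rewrite ltr0n.
have h1 : ln (N./2.+1%:R : R) <= ln N%:R.
  by rewrite ler_ln ?posrE // ler_nat; lia.
have h2 : ln (N%:R : R) <= ln (2 * N./2.+1%:R).
  by rewrite ler_ln ?posrE ?mulr_gt0 // -natrM ler_nat; lia.
have h3 : ln (2 : R) <= 1.
  by have := @le_ln1Dx R 1; rewrite -natr1; apply; lra.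
move: h2; rewrite lnM ?posrE // => h2.
by rewrite ler_norml; apply/andP; split; lra.
Qed.

(** * The sum of [1 / ||n alpha||] *)

(** The main part of the counts yields twice a harmonic sum. In the bound, the boundary term
    [N/(K + 1)], the harmonic sum and the passage from [K + 1] to [N] contribute 2 each, the count
    errors [2 E]. *)
Lemma count_inv_sum (R : realType) (X : nat -> R) (N : nat) (E : R) :
  (0 < N)%N ->
  (forall n, (n < N)%N -> X n < N./2.+1%:R) ->
  (forall k, (0 < k)%N -> (2 * k <= N)%N ->
     `|count_lt X N k%:R - 2 * k%:R| <= E * Num.sqrt k%:R) ->
  0 <= E ->
  `|\sum_(0 <= n < N) (Num.truncn (X n)).+1%:R^-1 - 2 * ln N%:R| <= 6 + 2 * E.
Proof.
move=> N0 hX hE E0; set K := N./2.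
have NK : N%:R / K.+1%:R <= 2 :> R.
  by rewrite ler_pdivrMr // -natrM ler_nat; lia.
have NK0 : 0 <= N%:R / K.+1%:R :> R by rewrite divr_ge0.
rewrite (@sum_trunc_count _ (fun k => k.+1%:R^-1) X N K hX).
pose w k : R := (k.+1%:R * k.+2%:R)^-1.
pose e k : R := count_lt X N k.+1%:R - 2 * k.+1%:R.
have wE k : k.+1%:R^-1 - k.+2%:R^-1 = w k :> R.
  have h1 : 0 <= k%:R :> R by [].
  rewrite /w -[k.+2%:R]natr1 -[k.+1%:R]natr1; field.
  by rewrite !gt_eqF //; lra.
have w2 k : k.+1%:R * w k = k.+2%:R^-1.
  by rewrite /w invfM mulrA mulfV ?mul1r // pnatr_eq0.
have -> : \sum_(0 <= k < K) count_lt X N k.+1%:R * (k.+1%:R^-1 - k.+2%:R^-1) =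
    2 * (\sum_(0 <= k < K) k.+2%:R^-1) + \sum_(0 <= k < K) e k * w k.
  rewrite mulr_sumr -big_split /=; apply: eq_bigr => k _.
  by rewrite wE -w2 /e; ring.
have he : `|\sum_(0 <= k < K) e k * w k| <= 2 * E.
  apply: (le_trans (ler_norm_sum _ _ _)).
  apply: (@le_trans _ _ (E * \sum_(0 <= k < K) Num.sqrt k.+1%:R * w k)).
    rewrite mulr_sumr; apply: ler_sum_nat => k /andP[_ kK].
    have w0 : 0 <= w k by rewrite invr_ge0 mulr_ge0.
    rewrite normrM (ger0_norm w0) mulrA ler_wpM2r // hE //.
    by move: kK; rewrite /K; lia.
  by rewrite mulrC ler_wpM2r // sum_sqrt_le.
have := @harmonic_ln R K; have := ln_half_succ R N0; rewrite -/K.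
move: he NK NK0; set A := \sum_(_ <= _ < _) e _ * _.
set H := \sum_(_ <= _ < _) _^-1.
rewrite !ler_norml.
move: (N%:R / K.+1%:R) (ln _) (ln _) => a b d.
move=> /andP[? ?] ? ? /andP[? ?] /andP[? ?]; apply/andP; split; lra.
Qed.

(** Differences of [1/(k + 1)^2] have order [k^(-3)], so the crude count bound [(2 + E) (k + 1)]
    already gives a convergent series. *)
Lemma count_inv_sqr_sum (R : realType) (X : nat -> R) (N : nat) (E : R) :
  (0 < N)%N ->
  (forall n, (n < N)%N -> X n < N./2.+1%:R) ->
  (forall k, (0 < k)%N -> (2 * k <= N)%N ->
     `|count_lt X N k%:R - 2 * k%:R| <= E * Num.sqrt k%:R) ->
  0 <= E ->
  \sum_(0 <= n < N) (Num.truncn (X n)).+1%:R ^- 2 <= 6 + 2 * E.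
Proof.
move=> N0 hX hE E0; set K := N./2.
have NK : N%:R * K.+1%:R ^- 2 <= 2 :> R.
  rewrite ler_pdivrMr ?exprn_gt0 // -natrX -natrM ler_nat.
  by rewrite /K; nia.
rewrite (@sum_trunc_count _ (fun k => k.+1%:R ^- 2) X N K hX).
suff : \sum_(0 <= k < K) count_lt X N k.+1%:R * (k.+1%:R ^- 2 - k.+2%:R ^- 2) <=
    (4 + 2 * E) * \sum_(0 <= k < K) (k.+1%:R * k.+2%:R)^-1.
  have h : (4 + 2 * E) * \sum_(0 <= k < K) (k.+1%:R * k.+2%:R)^-1 <= 4 + 2 * E.
    by rewrite ler_piMr ?sum_inv_mul_succ_le //; lra.
  move=> /le_trans /(_ h) {}h.
  by have := lerD NK h; have -> : 2 + (4 + 2 * E) = 6 + 2 * E by ring.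
rewrite mulr_sumr; apply: ler_sum_nat => k /andP[_ kK].
have k0 : 0 <= k%:R :> R by [].
have kk : 1 <= k.+1%:R :> R by rewrite ler1n.
have hs : Num.sqrt k.+1%:R <= k.+1%:R :> R.
  rewrite -[X in _ <= X]ger0_norm // -sqrtr_sqr ler_wsqrtr // expr2.
  by rewrite ler_peMr.
have hc : count_lt X N k.+1%:R <= (2 + E) * k.+1%:R.
  have := hE k.+1 isT; rewrite ler_norml => h.
  have /h /andP[_ {}h] : (2 * k.+1 <= N)%N by move: kK; rewrite /K; lia.
  have : E * Num.sqrt k.+1%:R <= E * k.+1%:R by rewrite ler_wpM2l.
  lra.
have hd : 0 <= (k.+1%:R ^- 2 - k.+2%:R ^- 2 : R)
    <= 2 / (k.+1%:R ^+ 2 * k.+2%:R).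
  rewrite -[k.+2%:R]natr1 -[k.+1%:R]natr1; move: (k%:R : R) k0 => x x0.
  have -> : (x + 1) ^- 2 - (x + 1 + 1) ^- 2 =
      (2 * x + 3) / ((x + 1) ^+ 2 * (x + 1 + 1) ^+ 2).
    by field; rewrite !gt_eqF //; lra.
  have -> : 2 / ((x + 1) ^+ 2 * (x + 1 + 1)) =
      (2 * x + 4) / ((x + 1) ^+ 2 * (x + 1 + 1) ^+ 2).
    by field; rewrite !gt_eqF //; lra.
  have d0 : 0 < ((x + 1) ^+ 2 * (x + 1 + 1) ^+ 2)^-1.
    by rewrite invr_gt0 mulr_gt0 // exprn_gt0 //; lra.
  by rewrite ler_pM2r // mulr_ge0 ?(ltW d0) //=; lra.
have /andP[hd0 hd1] := hd.
apply: (le_trans (ler_wpM2r hd0 hc)).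
have c0 : 0 <= (2 + E) * k.+1%:R by rewrite mulr_ge0 //; lra.
apply: (le_trans (ler_wpM2l c0 hd1)).
have -> : (2 + E) * k.+1%:R * (2 / (k.+1%:R ^+ 2 * k.+2%:R)) =
  (4 + 2 * E) * (k.+1%:R * k.+2%:R)^-1.
  by field; rewrite !gt_eqF //; lra.
by [].
Qed.

Lemma sum_inv_dist_int (R : realType) (alpha : R) : badly_approximable alpha ->
  exists C : R, forall N : nat, (1 <= N)%N ->
     `| \sum_(1 <= n < N.+1) (dist_int (n%:R * alpha))^-1
        - 2 * N%:R * ln N%:R | <= C * N%:R.
Proof.
move=> hb; have [c c0 hc] := badly_approximable_lb hb.
have [E E0 hE] := count_badly_approximable hb.
(* The first summand pays for replacing [X n] by its integer part plus 1, the second for the sum so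
   obtained. *)
exists ((1 + c^-1) * (6 + 2 * E) + (6 + 2 * E)) => N N0.
have N0R : 0 < N%:R :> R by rewrite ltr0n.
pose X n : R := N%:R * dist_int (n.+1%:R * alpha).
have cX n : (n < N)%N -> c <= X n.
  move=> nN; apply: (le_trans (hc n.+1 isT)).
  by rewrite ler_wpM2r ?dist_int_ge0 // ler_nat.
have XK n : (n < N)%N -> X n < N./2.+1%:R.
  move=> nN; have h := dist_int_le_half (n.+1%:R * alpha).
  apply: (@le_lt_trans _ _ (N%:R * (1 / 2))); first by rewrite ler_pM2l.
  rewrite mulrA mulr1 ltr_pdivrMr // -natrM ltr_nat; lia.
have h1 := count_inv_sum N0 XK (fun k => hE N k) E0.
have h2 := count_inv_sqr_sum N0 XK (fun k => hE N k) E0.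
have -> : \sum_(1 <= n < N.+1) (dist_int (n%:R * alpha))^-1 =
    N%:R * \sum_(0 <= n < N) (X n)^-1.
  rewrite big_add1 mulr_sumr; apply: eq_bigr => n _.
  by rewrite /X invfM mulrA mulfV ?mul1r // gt_eqF.
have -> : 2 * N%:R * ln N%:R = N%:R * (2 * ln N%:R) :> R by ring.
rewrite -mulrBr normrM (gtr0_norm N0R) mulrC ler_pM2r //.
apply: (le_trans (ler_distD
  (\sum_(0 <= n < N) (Num.truncn (X n)).+1%:R^-1) _ _)).
apply: lerD => //.
rewrite -sumrB; apply: (le_trans (ler_norm_sum _ _ _)).
apply: (@le_trans _ _ ((1 + c^-1) *
   \sum_(0 <= n < N) (Num.truncn (X n)).+1%:R ^- 2)).
  rewrite mulr_sumr; apply: ler_sum_nat => n /andP[_ nN].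
  exact/inv_truncn_approx/cX.
by rewrite ler_wpM2l // addr_ge0 // invr_ge0 ltW.
Qed.

(** * The sum weighted by [1/n] *)

Lemma log_err_ge (R : realType) (x : R) : 0 < x ->
  1 <= log_err x /\ ln x <= log_err x.
Proof.
move=> x0; have m0 : 0 < Num.max (expR 1) x by rewrite lt_max x0 orbT.
split; last by rewrite ler_ln ?posrE // le_max lexx orbT.
by rewrite -[X in X <= _](expRK 1) ler_ln ?posrE ?expR_gt0 // le_max lexx.
Qed.

(** With [a], [b] the two logarithms and [v = 1/(n + 1)], the quantity is
    [2 a (b - a - v) + (b - a)^2]. Here [0 <= b - a - v <= v/n] and [a <= n], while
    [(b - a)^2 <= 1/n <= 2 v]. *)
Lemma ln_sqr_succ (R : realType) (n : nat) : (0 < n)%N ->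
  `|ln (n.+1%:R : R) ^+ 2 - ln n%:R ^+ 2 - 2 * ln n%:R / n.+1%:R|
    <= 6 / n.+1%:R.
Proof.
move=> n0; have n0R : 0 < n%:R :> R by rewrite ltr0n.
have n1R : 1 <= n%:R :> R by rewrite ler1n.
have n1E : n.+1%:R = n%:R + 1 :> R by rewrite natr1.
have /andP[] := ln_succ_bounds R n0.
have := ln_sublinear n0R; have := ln_ge0 n1R.
set a := ln n%:R; set b := ln n.+1%:R; rewrite n1E => a0 an b1 b2.
move: (n%:R : R) n0R n1R an b1 b2 => x x0 x1 an b1 b2.
have x10 : 0 < x + 1 by lra.
have inv_le : x^-1 <= 2 / (x + 1).
  by rewrite ler_pdivlMr // ler_pdivrMl //; lra.
have xV1 : x^-1 <= 1 by rewrite invf_le1.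
have xV0 : 0 < x^-1 by rewrite invr_gt0.
have axV : a * x^-1 <= 1 by rewrite ler_pdivrMr // mul1r ltW.
have xE : x^-1 - (x + 1)^-1 = x^-1 * (x + 1)^-1.
  by field; rewrite !gt_eqF.
have yV0 : 0 < (x + 1)^-1 by rewrite invr_gt0.
move: (x^-1) ((x + 1)^-1) inv_le xV1 xV0 axV xE yV0 b1 b2 =>
  u v uv u1 u0 au uvE v0 b1 b2.
have -> : b ^+ 2 - a ^+ 2 - 2 * a * v =
  2 * a * (b - a - v) + (b - a) ^+ 2 by ring.
have h1 : 0 <= a * (b - a - v) <= v.
  apply/andP; split; first by rewrite mulr_ge0 //; lra.
  apply: (@le_trans _ _ (a * (u * v))); first by rewrite ler_wpM2l //; lra.
  by rewrite mulrA ler_piMl // ltW.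
have h2 : 0 <= (b - a) ^+ 2 <= 2 * v.
  apply/andP; split; first exact: sqr_ge0.
  apply: (@le_trans _ _ (u * 1)); last lra.
  by rewrite expr2 ler_pM //; lra.
move: h1 h2; move: (_ ^+ 2) (a * (b - a - v)) (mulrA 2 a (b - a - v)).
move=> s t <- /andP[? ?] /andP[? ?].
by rewrite ler_norml; apply/andP; split; lra.
Qed.

Lemma sum_div_of_sum (R : realType) (a : nat -> R) (C : R) :
  (forall N : nat, (1 <= N)%N ->
     `|\sum_(1 <= n < N.+1) a n - 2 * N%:R * ln N%:R| <= C * N%:R) ->
  forall N : nat, (1 <= N)%N ->
     `|\sum_(1 <= n < N.+1) a n / n%:R - ln N%:R ^+ 2|
       <= (2 * C + 8) * log_err N%:R.
Proof.
move=> hS.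
pose S N : R := \sum_(1 <= n < N.+1) a n.
pose T N : R := \sum_(1 <= n < N.+1) a n / n%:R.
pose L N : R := ln N%:R.
have C0 : 0 <= C by have := le_trans (normr_ge0 _) (hS 1%N isT); rewrite mulr1.
have SN N : (1 <= N)%N -> `|S N / N%:R - 2 * L N| <= C.
  move=> N0; have N0R : 0 < N%:R :> R by rewrite ltr0n.
  have -> : S N / N%:R - 2 * L N = (S N - 2 * N%:R * L N) / N%:R.
    by field; rewrite gt_eqF.
  rewrite normrM normfV (gtr0_norm N0R) ler_pdivrMr //; exact: hS.
have L0 N : (1 <= N)%N -> 0 <= L N by move=> N0; rewrite ln_ge0 // ler1n.
(* Abel summation: T N - S N / N is the sum of S n / (n (n+1)) over n < N,
   whose terms are close to the increments of (ln n)^2. *)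
have D N : (1 <= N)%N -> `|T N - S N / N%:R - L N ^+ 2| <= (C + 6) * L N.
  (* At [N = 1] both sides vanish: [T] and [S/N] agree and [ln 1 = 0]. So the bound needs no
     constant term. *)
  elim: N => [//|[|N] IH] _.
    by rewrite /T /S /L !big_nat1 ln1 subrr expr0n /= subr0 normr0 mulr0.
  set n := N.+1 in IH *; have n0 : (0 < n)%N by [].
  have {}IH := IH isT.
  have n1E : n.+1%:R = n%:R + 1 :> R by rewrite natr1.
  have n0R : 0 < n%:R :> R by [].
  have SS : S n.+1 = S n + a n.+1 by rewrite /S big_nat_recr.
  have TS : T n.+1 = T n + a n.+1 / n.+1%:R by rewrite /T big_nat_recr.
  have /andP[hl _] := ln_succ_bounds R n0.
  have hq := ln_sqr_succ R n0.
  have hs := SN n n0.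
  have n1R : 0 < n.+1%:R :> R by [].
  have hs' : `|(S n / n%:R - 2 * L n) / n.+1%:R| <= C / n.+1%:R.
    by rewrite normrM normfV (gtr0_norm n1R) ler_pM2r ?invr_gt0.
  have -> : T n.+1 - S n.+1 / n.+1%:R - L n.+1 ^+ 2 =
    (T n - S n / n%:R - L n ^+ 2) + (S n / n%:R - 2 * L n) / n.+1%:R
    - (L n.+1 ^+ 2 - L n ^+ 2 - 2 * L n / n.+1%:R).
    rewrite SS TS n1E; field; rewrite !gt_eqF //; lra.
  apply: (le_trans (ler_normB _ _)).
  apply: (@le_trans _ _ ((C + 6) * L n + C / n.+1%:R + 6 / n.+1%:R)).
    apply: lerD; last exact: hq.
    by apply: (le_trans (ler_normD _ _)); apply: lerD.
  (* The new error [(C + 6)/(n + 1)] is absorbed by the growth of [(C + 6) L], as [L] increases by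
     at least [1/(n + 1)]. *)
  have := ler_wpM2l (_ : 0 <= C + 6) hl; rewrite -/(L n) -/(L n.+1).
  move=> /(_ ltac:(lra)); move: (n.+1%:R^-1 : R) => v; lra.
move=> N N0; have N0R : 0 < N%:R :> R by rewrite ltr0n.
have [le1 le2] := log_err_ge N0R.
have h1 := SN N N0; have h2 := D N N0; have h3 := L0 N N0.
rewrite -[X in `|X - _|]/(T N) -/(L N); rewrite -/(L N) in le2.
have -> : T N - L N ^+ 2 = (T N - S N / N%:R - L N ^+ 2) +
  (S N / N%:R - 2 * L N) + 2 * L N by ring.
(* The stray [C] is absorbed by [log_err >= 1]; at [N = 1] the plain logarithm would be 0. *)
apply: (@le_trans _ _ ((C + 6) * L N + C + 2 * L N)).
  apply: (le_trans (ler_normD _ _)).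
  rewrite [`|2 * _|]ger0_norm; last by rewrite mulr_ge0.
  by apply: lerD => //; apply: (le_trans (ler_normD _ _)); apply: lerD.
nra.
Qed.

Unset Implicit Arguments.

Theorem theorem1 (R : realType) (alpha : R)
    (halpha_irr : irrational alpha) (halpha : badly_approximable alpha) :
  (exists C : R, forall N : nat, (1 <= N)%N ->
     `| \sum_(1 <= n < N.+1) (dist_int (n%:R * alpha))^-1
        - 2 * N%:R * ln N%:R | <= C * N%:R)
  /\
  (exists C : R, forall N : nat, (1 <= N)%N ->
     `| \sum_(1 <= n < N.+1) (n%:R * dist_int (n%:R * alpha))^-1
        - (ln N%:R) ^+ 2 | <= C * log_err N%:R).
Proof.
have [C hC] := sum_inv_dist_int halpha.
split; first by exists C.
exists (2 * C + 8) => N N0; have := sum_div_of_sum hC N0.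
have -> : \sum_(1 <= n < N.+1) (n%:R * dist_int (n%:R * alpha))^-1 =
    \sum_(1 <= n < N.+1) (dist_int (n%:R * alpha))^-1 / n%:R.
  by apply: eq_bigr => n _; rewrite invfM mulrC.
by [].
Qed.
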